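(* Let $R$ be a nonzero ring and $G$ a group. If the group ring $RG$ is a $W\sqrt{J}U$ ring, then $G$ is a torsion group (every element of $G$ has finite order).
   Context: Rings are associative with identity, not necessarily commutative. For a ring $A$, $U(A)$ is its group of units, $J(A)$ its Jacobson radical, and $\sqrt{J(A)}=\{x\in A : x^n\in J(A)\text{ for some } n\ge 1\}$. A ring $A$ is $W\sqrt{J}U$ (weakly $\sqrt{J}U$) if $U(A)=\pm 1+\sqrt{J(A)}$; equivalently, every unit of $A$ can be written as $j+1$ or as $j-1$ for some $j\in\sqrt{J(A)}$. *)

(* Defs.v *)
From HB Require Import structures.
From mathcomp Require Import all_boot all_algebra finmap.
From mathcomp.multinomials Require Import monalg.

Set Implicit Arguments.
Unset Strict Implicit.
Unset Printing Implicit Defensive.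

Import GRing.Theory.

Local Open Scope ring_scope.

(* [{malg R[G]}] is the additive group of finitely supported functions G -> R,
   with coefficients [x@_g] and single terms [<< a *g g >>]. The product monalg
   puts on it is of no use here: it needs a [monomType], whose axiom [unitm]
   (a product is 1 only if both factors are) fails in every nontrivial group.
   Hence the separate name, carrying the convolution product of a group. *)
Definition group_ring (R : nzRingType) (G : groupType) : predArgType :=
  {malg R[G]}.

Section GroupRing.
Local Open Scope fset_scope.
Variables (R : nzRingType) (G : groupType).
Implicit Types (x y z : {malg R[G]}) (g h : G).

HB.instance Definition _ := GRing.Zmodule.on (group_ring R G).

Definition gr_one : {malg R[G]} := << (1 : R) *g (1%g : G) >>.

Definition gr_mul x y : {malg R[G]} :=
  \sum_(g <- msupp x) \sum_(h <- msupp y) << x@_g * y@_h *g (g * h)%g >>.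

Lemma gr_mulw (d e : {fset G}) x y : msupp x `<=` d -> msupp y `<=` e ->
  gr_mul x y = \sum_(g <- d) \sum_(h <- e) << x@_g * y@_h *g (g * h)%g >>.
Proof.
move=> sxd sye; rewrite /gr_mul (big_fset_incl _ sxd) /=; last first.
  move=> g _ /mcoeff_outdom xg.
  by rewrite big1 // => h _; rewrite xg mul0r monalgU0.
apply: eq_bigr => g _; apply: big_fset_incl => // h _ /mcoeff_outdom ->.
by rewrite mulr0 monalgU0.
Qed.

Lemma gr_mulU (a b : R) g h :
  gr_mul << a *g g >> << b *g h >> = << a * b *g (g * h)%g >>.
Proof. by rewrite (gr_mulw msuppU_le msuppU_le) !big_seq_fset1 !mcoeffUU. Qed.

Lemma gr_mulDl : left_distributive gr_mul +%R.
Proof.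
move=> x y z; rewrite (gr_mulw (msuppD_le x y) (fsubset_refl _)).
rewrite (gr_mulw (fsubsetUl _ (msupp y)) (fsubset_refl (msupp z))).
rewrite (gr_mulw (fsubsetUr (msupp x) _) (fsubset_refl (msupp z))).
rewrite -big_split; apply: eq_bigr => g _; rewrite -big_split.
by apply: eq_bigr => h _; rewrite mcoeffD mulrDl monalgUD.
Qed.

Lemma gr_mulDr : right_distributive gr_mul +%R.
Proof.
move=> x y z; rewrite (gr_mulw (fsubset_refl _) (msuppD_le y z)).
rewrite (gr_mulw (fsubset_refl (msupp x)) (fsubsetUl _ (msupp z))).
rewrite (gr_mulw (fsubset_refl (msupp x)) (fsubsetUr (msupp y) _)).
rewrite -big_split; apply: eq_bigr => g _; rewrite -big_split.
by apply: eq_bigr => h _; rewrite mcoeffD mulrDr monalgUD.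
Qed.

Lemma gr_mul0x : left_zero 0 gr_mul.
Proof. by move=> x; rewrite /gr_mul msupp0 big_seq_fset0. Qed.

Lemma gr_mulx0 : right_zero 0 gr_mul.
Proof.
by move=> x; rewrite /gr_mul big1 // => g _; rewrite msupp0 big_seq_fset0.
Qed.

Lemma gr_mul_suml I (r : seq I) (F : I -> {malg R[G]}) y :
  gr_mul (\sum_(i <- r) F i) y = \sum_(i <- r) gr_mul (F i) y.
Proof. exact: (big_morph (gr_mul^~ y) (fun _ _ => gr_mulDl _ _ _) (gr_mul0x _)). Qed.

Lemma gr_mul_sumr I (r : seq I) (F : I -> {malg R[G]}) x :
  gr_mul x (\sum_(i <- r) F i) = \sum_(i <- r) gr_mul x (F i).
Proof. exact: (big_morph (gr_mul x) (fun _ _ => gr_mulDr _ _ _) (gr_mulx0 _)). Qed.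

Lemma gr_mul1x : left_id gr_one gr_mul.
Proof.
move=> x; rewrite {1}(monalgE x) gr_mul_sumr [RHS]monalgE.
by apply: eq_bigr => g _; rewrite gr_mulU mul1r mul1g.
Qed.

Lemma gr_mulx1 : right_id gr_one gr_mul.
Proof.
move=> x; rewrite {1}(monalgE x) gr_mul_suml [RHS]monalgE.
by apply: eq_bigr => g _; rewrite gr_mulU mulr1 mulg1.
Qed.

Lemma gr_mulA : associative gr_mul.
Proof.
move=> x y z; rewrite (monalgE x) !gr_mul_suml; apply: eq_bigr => g _.
rewrite (monalgE y) gr_mul_suml !gr_mul_sumr gr_mul_suml; apply: eq_bigr => h _.
rewrite (monalgE z) !gr_mul_sumr; apply: eq_bigr => k _.
by rewrite !gr_mulU mulrA mulgA.
Qed.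

Lemma gr_one_neq0 : gr_one != 0.
Proof. by rewrite monalgU_eq0 oner_eq0. Qed.

HB.instance Definition _ := GRing.Zmodule_isNzRing.Build (group_ring R G)
  gr_mulA gr_mul1x gr_mulx1 gr_mulDl gr_mulDr gr_one_neq0.

End GroupRing.

Section RadicalUnits.
Variable A : pzRingType.
Implicit Types (I L : A -> Prop) (x u : A).

(* Ideals are Prop-valued since arbitrary, possibly undecidable, ones must be
   considered. For the same reason units are not taken from [unitRingType],
   which presupposes that invertibility is decidable. *)
Definition is_unit u := exists v, v * u = 1 /\ u * v = 1.

Definition left_ideal I :=
  [/\ I 0, (forall x y, I x -> I y -> I (x + y)) &
      (forall a x, I x -> I (a * x))].

Definition maximal_left_ideal I :=
  [/\ left_ideal I, ~ I 1 &
      forall L, left_ideal L -> (forall x, I x -> L x) -> ~ L 1 ->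
        forall x, L x -> I x].

Definition jacobson_radical x :=
  forall I, maximal_left_ideal I -> I x.

Definition sqrt_jacobson x :=
  exists n : nat, (0 < n)%N /\ jacobson_radical (x ^+ n).

(* The equality of sets U(A) = (1 + sqrt(J(A))) \cup (-1 + sqrt(J(A))). *)
Definition WsqrtJU :=
  forall u, is_unit u <->
    exists j, sqrt_jacobson j /\ (u = 1 + j \/ u = -1 + j).

End RadicalUnits.

Definition torsion_group (G : groupType) :=
  forall g : G, exists n : nat, (0 < n)%N /\ (g ^+ n = 1)%g.

(* Main.v *)
Require Import Defs.
From mathcomp Require Import all_boot all_algebra.
From mathcomp Require Import finmap boolp classical_sets.
From mathcomp.multinomials Require Import monalg.

(** When g has infinite order, the powers of g span a Laurent polynomial ring
    inside RG. A Laurent polynomial with at least two terms, whose lowest and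
    highest coefficients are 1, has no left inverse: in a product with it,
    neither the lowest nor the highest term can cancel, so the product again
    has at least two terms. The argument goes through for a left inverse in
    the whole of RG, by looking at one coset of the powers of g at a time
    ([left_inverse_finite_order]).

    On the other hand, g is a unit of RG, so the hypothesis gives a sign c and
    an n such that (g - c)^n lies in J(RG). Then 1 + g (g - c)^n has a left
    inverse ([jacobson_radical_left_inverse]), although it is a polynomial in g
    of degree n + 1 with lowest and highest coefficients 1. The factor g is
    there to remove the constant term of (g - c)^n, so that the lowest
    coefficient of the sum is 1 and its highest one comes from a positive
    degree. Hence g cannot have infinite order. *)

Set Implicit Arguments.
Unset Strict Implicit.
Unset Printing Implicit Defensive.

Import GRing.Theory.

Local Open Scope ring_scope.

Section JacobsonRadical.
Variable A : pzRingType.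
Implicit Types (I : A -> Prop) (a x : A).

(** This is Zorn's lemma: the union of a nonempty chain of proper left ideals
    is a left ideal that still misses 1. *)
Lemma exists_maximal_left_ideal I : left_ideal I -> ~ I 1 ->
  exists2 M, maximal_left_ideal M & forall x, I x -> M x.
Proof.
move=> idI I1.
pose good B := [/\ left_ideal B, ~ B 1 & forall x, I x -> B x].
(* The empty set is admitted because it is the union of the empty chain. *)
pose P : set (set A) := fun B => (exists x, B x) -> good B.
have [F FP totF [x0 [X0 FX0 X0x0]]|M [PM maxM]] := @Zorn_bigcup A P.
  have FG X x : F X -> X x -> good X.
    by move=> FX Xx; apply: (FP _ FX); exists x.
  have [[X00 _ _] _ IX0] := FG _ _ FX0 X0x0.
  split; last by move=> x Ix; exists X0 => //; apply: IX0.
    split; first by exists X0.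
      move=> x y [X FX Xx] [Y FY Yy].
      have [[_ addX _] _ _] := FG _ _ FX Xx.
      have [[_ addY _] _ _] := FG _ _ FY Yy.
      have [XY|YX] := totF _ _ FX FY; first by exists Y => //; apply/addY/Yy/XY.
      by exists X => //; apply: addX => //; apply: YX.
    move=> a x [X FX Xx]; exists X => //.
    by have [[_ _ mulX] _ _] := FG _ _ FX Xx; apply: mulX.
  by move=> [X FX X1]; have [] := FG _ _ FX X1.
have max_good B : good B -> (forall x, M x -> B x) -> forall x, B x -> M x.
  move=> gB MB x Bx; have [//|nMx] := pselect (M x); exfalso.
  by apply: (maxM B) => [|_]; [split=> // BM; apply/nMx/BM | apply: gB].
have [idM M1 IM] : good M.
  apply: PM; have [//|nM] := pselect (exists x, M x); exists 0.
  have I0 : I 0 by case: idI.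
  by apply: (max_good I) => // x Mx; case: nM; exists x.
exists M => //; split=> // L idL ML L1.
by apply: max_good => //; split=> // x Ix; apply/ML/IM.
Qed.

(** Without a left inverse, 1 + a x would generate a proper left ideal, hence
    lie in a maximal one, together with a x. *)
Lemma jacobson_radical_left_inverse a x :
  jacobson_radical x -> exists y, y * (1 + a * x) = 1.
Proof.
move=> Jx; pose I z := exists y, y * (1 + a * x) = z.
have [//|nI] := pselect (I 1).
have [|M maxM IM] := @exists_maximal_left_ideal I _ nI.
  split; first by exists 0; rewrite mul0r.
    by move=> _ _ [y <-] [z <-]; exists (y + z); rewrite mulrDl.
  by move=> b _ [y <-]; exists (b * y); rewrite mulrA.
have [[_ addM mulM] M1 _] := maxM; case: M1.
rewrite -[1](addrK (a * x)) -mulNr; apply: addM; last by apply: mulM; apply: Jx.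
by apply: IM; exists 1; rewrite mul1r.
Qed.

End JacobsonRadical.

Section LeftInverse.
Variables (R : nzRingType) (G : groupType).
Implicit Types (v x : group_ring R G) (c : R) (g h k : G).

Lemma mcoeff_mulU x c k h :
  (x * << c *g k >> : group_ring R G)@_h = x@_(h * k^-1)%g * c.
Proof.
rewrite [_ * _](gr_mulw (fsubset_refl _) msuppU_le).
rewrite (eq_bigr (fun g => << x@_g * c *g (g * k)%g >>)); last first.
  by move=> g _; rewrite big_seq_fset1 mcoeffUU.
have eqk g : (g * k == h)%g = (g == h * k^-1)%g.
  by apply/eqP/eqP => [<-|->]; rewrite ?mulgK ?mulgVK.
rewrite raddf_sum /=; under eq_bigr do rewrite mcoeffU eqk.
case: (msuppP x (h * k^-1)%g) => [xh|xh].
  rewrite (big_fsetD1 _ xh) /= eqxx big1_fset ?addr0 // => g.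
  by rewrite !inE => /andP[/negPf->].
rewrite mul0r big1_fset // => g xg _; case: eqP => // eg.
by rewrite eg (negPf xh) in xg.
Qed.

(** Walking along h, h g, h g^2, ... from a point of a finite set, there is a
    last visit to it, since otherwise g would have finite order. *)
Lemma last_visit (S : {fset G}) g h :
    (forall n, (0 < n)%N -> (g ^+ n)%g <> 1%g) -> h \in S ->
  exists n, (h * g ^+ n)%g \in S
    /\ forall i, (0 < i)%N -> (h * g ^+ n * g ^+ i)%g \notin S.
Proof.
move=> ginf; have [m] := ubnP #|` S|; elim: m => // m IHm in S h * => Sm Sh.
have [[i [i_gt0 Si]]|noi] :=
  pselect (exists i, (0 < i)%N /\ (h * g ^+ i)%g \in S); last first.
  exists 0%N; rewrite expg0 mulg1; split=> // i i_gt0.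
  by apply/negP => Si; apply: noi; exists i.
have neqh j : (0 < j)%N -> (h * g ^+ j)%g != h.
  by move=> /ginf gj; apply/eqP => /(canRL (mulKg _)); rewrite mulVg.
have [||n [Sn lastn]] := IHm (S `\ h)%fset (h * g ^+ i)%g.
- by move: Sm; rewrite (cardfsD1 h S) Sh.
- by rewrite !inE neqh.
exists (i + n)%N; rewrite expgnDr mulgA; split.
  by move: Sn; rewrite !inE => /andP[].
move=> j j_gt0; have := lastn _ j_gt0; rewrite !inE negb_and negbK.
by rewrite -!mulgA -!expgnDr (negPf (neqh _ _)) // !addn_gt0 i_gt0.
Qed.

(** If g had infinite order, v would have a highest and a lowest term in the
    coset of some h0, at h0 g^k and h0 g^(-l). Multiplied by the highest and
    the lowest term of the right factor, they give terms of the product at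
    h0 g^(k+n+1) and h0 g^(-l), where nothing can cancel them. The product is
    1, so both places are the identity of G, and g^(l+k+n+1) = 1. *)
Lemma left_inverse_finite_order g c (n : nat) v :
    let X := << 1 *g g >> : group_ring R G in
    v * (1 + X * (X - << c *g 1%g >>) ^+ n) = 1 ->
  exists m, (0 < m)%N /\ (g ^+ m = 1)%g.
Proof.
move=> X; set Y := X - _ => v1.
have [//|nofin] := pselect (exists m, (0 < m)%N /\ (g ^+ m = 1)%g).
have ginf m : (0 < m)%N -> (g ^+ m)%g <> 1%g.
  by move=> m0 gm; apply: nofin; exists m.
have coefX x h : (x * X)@_h = x@_(h * g^-1)%g by rewrite mcoeff_mulU mulr1.
have coefY x h : (x * Y)@_h = x@_(h * g^-1)%g - x@_h * c.
  by rewrite mulrBr mcoeffB coefX mcoeff_mulU invg1 mulg1.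
(* Right multiplication by X, or by X - c, moves the last coefficient of a
   coset one step further along the powers of g, and puts nothing before its
   first one. *)
pose top x h a := x@_h = a /\ forall i, (0 < i)%N -> x@_(h * g ^+ i)%g = 0.
pose below x h := forall i, x@_(h * g^-1 ^+ i)%g = 0.
have gSV h i : (h * g * g ^+ i * g^-1 = h * g ^+ i)%g.
  by rewrite -[(h * g * _)%g]mulgA -expgS expgSr mulgA mulgK.
have topX x h a : top x h a -> top (x * X) (h * g)%g a.
  case=> xh xi; split=> [|i i_gt0]; rewrite coefX ?mulgK //.
  by rewrite gSV xi.
have topY x h a : top x h a -> top (x * Y) (h * g)%g a.
  case=> xh xi; have /= [h1 hi] := topX _ _ _ (conj xh xi).
  split=> [|i i_gt0]; rewrite coefY -coefX ?h1 ?hi //.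
    by have := xi 1%N isT; rewrite expg1 => ->; rewrite mul0r subr0.
  by rewrite -mulgA -expgS xi // mul0r subr0.
have topYn x h a : top x h a -> top (x * Y ^+ n) (h * g ^+ n)%g a.
  elim: (n) => [|m IHm] xh; first by rewrite expr0 mulr1 expg0 mulg1.
  by rewrite exprSr mulrA expgSr mulgA; apply/topY/IHm.
have belowY x h : below x h -> below (x * Y) h.
  by move=> xh i; rewrite coefY -mulgA -expgSr !xh mul0r subr0.
have belowYn x h : below x h -> below (x * Y ^+ n) h.
  elim: (n) => [|m IHm] xh; first by rewrite expr0 mulr1.
  by rewrite exprSr mulrA; apply/belowY/IHm.
have coef1 h : (v * (1 + X * Y ^+ n))@_h != 0 -> h = 1%g.
  by rewrite v1 mcoeffU; case: (1%g =P h) => [<- //|_]; rewrite eqxx.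
have expV m : (g^-1 ^+ m = (g ^+ m)^-1)%g by rewrite expVgn.
have ginfV m : (0 < m)%N -> (g^-1 ^+ m)%g <> 1%g.
  by move=> /ginf gm; rewrite expV => /(canRL invgK); rewrite invg1.
have /fset0Pn[h0 vh0] : msupp v != fset0.
  apply/eqP => v0; suff vE : v = 0.
    by move/eqP: v1; rewrite vE mul0r eq_sym oner_eq0.
  by apply/malgP => h; rewrite mcoeff0 mcoeff_outdom // v0.
have [k [vk lastk]] := last_visit ginf vh0.
have [l [vl lastl]] := last_visit ginfV vh0.
have hiE : (h0 * g ^+ k * g ^+ n.+1)%g = 1%g.
  apply: coef1; rewrite mulrDr mulr1 mcoeffD.
  rewrite [v@_ _]mcoeff_outdom ?lastk // add0r; set a := v@_(h0 * g ^+ k)%g.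
  have [] : top (v * X * Y ^+ n) (h0 * g ^+ k * g * g ^+ n)%g a.
    by apply/topYn/topX; split=> // i /lastk/mcoeff_outdom.
  by rewrite mulrA -[in X in X -> _]mulgA -expgS => -> _; rewrite mcoeff_neq0.
have loE : (h0 * g^-1 ^+ l)%g = 1%g.
  apply: coef1; rewrite mulrDr mulr1 mcoeffD mulrA.
  have /(_ 0%N) : below (v * X * Y ^+ n) (h0 * g^-1 ^+ l)%g.
    apply: belowYn => i; rewrite coefX -mulgA -expgSr.
    by rewrite mcoeff_outdom ?lastl.
  by rewrite expg0 mulg1 => ->; rewrite addr0 mcoeff_neq0.
have h0E : h0 = (g ^+ l)%g.
  by move: loE; rewrite expV => /(canRL (mulgVK _)); rewrite mul1g.
case: nofin; exists (l + (k + n.+1))%N; split; first by rewrite !addnS.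
by rewrite !expgnDr mulgA -h0E.
Qed.

End LeftInverse.

Theorem lemma3p2 (R : nzRingType) (G : groupType) :
  WsqrtJU (group_ring R G) -> torsion_group G.
Proof.
move=> WJU g; pose X : group_ring R G := << 1 *g g >>.
have unitX : is_unit X.
  exists (<< 1 *g g^-1%g >> : group_ring R G).
  by split; rewrite [LHS]gr_mulU mulr1 ?mulVg ?mulgV.
have [j [[n [_ Jj]] jX]] := (WJU X).1 unitX.
have [c jE] : exists c : R, j = X - << c *g 1%g >>.
  case: jX => jX; [exists 1 | exists (- 1)]; rewrite ?monalgUN;
    by apply: (canRL (addrK _)); rewrite jX addrC.
have [v v1] := jacobson_radical_left_inverse X Jj.
by move: v1; rewrite jE; apply: left_inverse_finite_order.
Qed.
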